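(* Let $\Gamma$ be a monoid with identity $e$ and let $A$ be a $\Gamma$-graded $\Bbbk$-algebra. Let $X$ be a reduced affine scheme over $\Bbbk$ that parameterises a set of intermediate series right $A$-modules, in the following sense: for each $x \in X$ there is a $\Gamma$-graded right $A$-module $M^x$ with a $\Bbbk$-basis $\{v^x_\gamma \mid \gamma \in \Gamma\}$, where $v^x_\gamma$ spans $(M^x)_\gamma$, and there is a $\Bbbk$-linear function $\phi: A \to \Bbbk[X]$ such that \[ v^x_e\, r = \phi(r)(x)\, v^x_\gamma \qquad \text{for all } x \in X,\ \gamma \in \Gamma,\ r \in A_\gamma. \] Suppose further that shifting defines an antihomomorphism $\sigma: \Gamma \to \mathrm{Aut}_\Bbbk(X)$, $\gamma \mapsto \sigma^\gamma$ (so $\sigma^{\gamma\delta} = \sigma^\delta \circ \sigma^\gamma$), such that for all $x\in X$ and $\gamma \in \Gamma$ there is an isomorphism of graded right $A$-modules $M^x(\gamma) \cong M^{\sigma^\gamma(x)}$ which maps $v^x_{\gamma\delta} \in M^x(\gamma)_\delta$ to $v^{\sigma^\gamma(x)}_\delta$ for all $\delta \in \Gamma$. Then the $\Bbbk$-linear map \[ \Phi: A \to \Bbbk[X] \rtimes \Gamma, \qquad \Phi(r) = \phi(r)\, t^\gamma \ \text{ for } r \in A_\gamma, \] is a graded homomorphism of algebras. Further, \[ \ker \Phi = \bigcap_{x \in X} \mathrm{Ann}_A\, M^x. \]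
   Context: $\Bbbk$ is an algebraically closed field of characteristic zero. A $\Gamma$-graded algebra is $A = \bigoplus_{\gamma\in\Gamma} A_\gamma$ with $A_\gamma A_\delta \subseteq A_{\gamma\delta}$; a $\Gamma$-graded right $A$-module is $M = \bigoplus_{\gamma} M_\gamma$ with $M_\gamma A_\delta \subseteq M_{\gamma\delta}$. An intermediate series module is a $\Gamma$-graded module $M$ with $\dim_\Bbbk M_\gamma = 1$ for all $\gamma \in \Gamma$. For a $\Gamma$-graded right $A$-module $M$ and $\gamma \in \Gamma$, the shift $M(\gamma)$ is the $\Gamma$-graded right $A$-module $M(\gamma) = \bigoplus_{\delta \in \Gamma} M(\gamma)_\delta$ with $M(\gamma)_\delta = M_{\gamma\delta}$. Points $x\in X$ are closed points, at which a function $f \in \Bbbk[X]$ takes a value $f(x) \in \Bbbk$; a function in $\Bbbk[X]$ is determined by its values at the closed points (as is the case when $X$ is reduced of finite type over $\Bbbk$). $\Gamma$ acts on $\Bbbk[X]$ by $f^\gamma = (\sigma^\gamma)^*(f)= f\circ \sigma^\gamma$, and $\Bbbk[X] \rtimes \Gamma = \bigoplus_{\gamma \in \Gamma} \Bbbk[X] t^\gamma$ is the $\Gamma$-graded algebra with multiplication determined by $t^\gamma t^\delta = t^{\gamma\delta}$ and $t^\gamma f = f^\gamma t^\gamma$ for $f \in \Bbbk[X]$. *)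

(* Defs.v *)
From HB Require Import structures.
From mathcomp Require Import all_boot all_order all_algebra.
From mathcomp Require Import finmap.
From mathcomp.multinomials Require Import monalg.

Set Implicit Arguments.
Unset Strict Implicit.
Unset Printing Implicit Defensive.

Import GRing.Theory.
Local Open Scope ring_scope.

Section Additive.
Context (V W : zmodType) (f : V -> W).
Hypothesis fB : zmod_morphism f.

Lemma additive0 : f 0 = 0.
Proof. by have := fB 0 0; rewrite !subrr. Qed.

Lemma additiveD : {morph f : u v / u + v}.
Proof.
move=> u v; rewrite -[v in LHS]opprK fB -[- v]sub0r fB additive0.
by rewrite sub0r opprK.
Qed.

End Additive.

Section LinearFacts.
Context (k : nzRingType) (V W : lmodType k) (f : V -> W).
Hypothesis f_lin : linear f.

Lemma linear_additive : zmod_morphism f.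
Proof. by move=> u v; rewrite addrC -scaleN1r f_lin scaleN1r addrC. Qed.

Lemma linear_scale a : {morph f : u / a *: u}.
Proof.
by move=> u; rewrite -[a *: u]addr0 f_lin (additive0 linear_additive) addr0.
Qed.

End LinearFacts.

Lemma linear_intro (k : nzRingType) (V W : lmodType k) (f : V -> W) :
  zmod_morphism f -> (forall a, {morph f : u / a *: u}) -> linear f.
Proof. by move=> fB fZ a u v; rewrite (additiveD fB) fZ. Qed.

(* [dsum Gamma V] is the direct sum of copies of [V] indexed by [Gamma]: finitely
   supported functions [c], with value [c@_g] at [g]; [<< v *g g >>] is the
   element [v] of the copy of index [g].  The scalars are those of [V], whereas
   the module structure of the library on [{malg R[K]}] has its scalars in the
   coefficient ring [R]. *)
Definition dsum (R : nzRingType) (Gamma : choiceType) (V : lmodType R) :=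
  {malg V[Gamma]}.

Section SumMap.
Context (Gamma : choiceType).

Definition sum_map (V W : zmodType) (h : Gamma -> V -> W) (c : {malg V[Gamma]}) : W :=
  \sum_(g <- msupp c) h g c@_g.

Context (V W : zmodType) (h : Gamma -> V -> W).
Hypothesis h_add : forall g, zmod_morphism (h g).

Lemma sum_mapw (d : {fset Gamma}) (c : {malg V[Gamma]}) :
  (msupp c `<=` d)%fset -> sum_map h c = \sum_(g <- d) h g c@_g.
Proof.
move=> le_d; apply: big_fset_incl le_d _ => g _ /mcoeff_outdom ->.
exact: additive0.
Qed.

Lemma sum_map_additive : zmod_morphism (sum_map h).
Proof.
move=> c d; pose D := (msupp c `|` msupp d)%fset.
rewrite (@sum_mapw D (c - d)) ?msuppB_le //.
rewrite (@sum_mapw D c) ?fsubsetUl // (@sum_mapw D d) ?fsubsetUr //.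
by rewrite -sumrB; apply: eq_bigr => g _; rewrite mcoeffB h_add.
Qed.

Lemma sum_mapU g v : sum_map h << v *g g >> = h g v.
Proof.
by rewrite (sum_mapw msuppU_le) big_seq_fset1 mcoeffUU.
Qed.

End SumMap.

Lemma malg_additive_ext (Gamma : choiceType) (V W : zmodType)
    (F G : {malg V[Gamma]} -> W) :
    zmod_morphism F -> zmod_morphism G ->
  (forall g v, F << v *g g >> = G << v *g g >>) -> F =1 G.
Proof.
move=> Fa Ga eqFG c.
rewrite (monalgE c) (big_morph F (additiveD Fa) (additive0 Fa)).
by rewrite (big_morph G (additiveD Ga) (additive0 Ga)); apply: eq_bigr.
Qed.

Section DsumLmodule.
Context (R : nzRingType) (Gamma : choiceType) (V : lmodType R).

HB.instance Definition _ := GRing.Zmodule.on (dsum Gamma V).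

Definition dsum_scale (a : R) (c : dsum Gamma V) : dsum Gamma V :=
  \sum_(g <- msupp c) << a *: c@_g *g g >>.

Lemma dsum_scaleE a c g : (dsum_scale a c)@_g = a *: c@_g.
Proof.
rewrite /dsum_scale raddf_sum /=.
have [gc|gc] := boolP (g \in msupp c).
  rewrite (big_fsetD1 g) //= mcoeffUU big1_fset ?addr0 // => i.
  by rewrite in_fsetD1 => /andP[neq _] _; rewrite mcoeffU (negbTE neq).
rewrite (mcoeff_outdom gc) scaler0 big1_fset // => i ic _.
by rewrite mcoeffU; case: eqP ic gc => [->|//] ->.
Qed.

Fact dsum_scaleA a b c : dsum_scale a (dsum_scale b c) = dsum_scale (a * b) c.
Proof. by apply/malgP => g; rewrite !dsum_scaleE scalerA. Qed.
Fact dsum_scale1 : left_id 1 dsum_scale.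
Proof. by move=> c; apply/malgP => g; rewrite dsum_scaleE scale1r. Qed.
Fact dsum_scaleDr : right_distributive dsum_scale +%R.
Proof.
by move=> a c d; apply/malgP => g; rewrite mcoeffD !dsum_scaleE mcoeffD scalerDr.
Qed.
Fact dsum_scaleDl c : {morph dsum_scale^~ c : a b / a + b}.
Proof.
by move=> a b; apply/malgP => g; rewrite mcoeffD !dsum_scaleE scalerDl.
Qed.

HB.instance Definition _ := GRing.Zmodule_isLmodule.Build R (dsum Gamma V)
  dsum_scaleA dsum_scale1 dsum_scaleDr dsum_scaleDl.

Lemma dsumZE (a : R) (c : dsum Gamma V) g : (a *: c)@_g = a *: c@_g.
Proof. exact: dsum_scaleE. Qed.

Lemma dsumZU (a : R) g (v : V) :
  a *: (<< v *g g >> : dsum Gamma V) = << a *: v *g g >>.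
Proof.
apply/malgP => i; rewrite dsumZE !mcoeffU.
by case: (g == i); rewrite ?mulr1n ?mulr0n ?scaler0.
Qed.

Definition dsum_total (c : dsum Gamma V) : V := sum_map (fun _ v => v) c.

End DsumLmodule.

Section Convolution.
Context (Gamma : monoidType).

Definition conv (U V W : zmodType) (f : Gamma -> U -> V -> W)
    (c : {malg U[Gamma]}) (d : {malg V[Gamma]}) : {malg W[Gamma]} :=
  \sum_(g <- msupp c) \sum_(h <- msupp d) << f g c@_g d@_h *g (g * h)%g >>.

Definition biadditive (U V W : zmodType) (f : Gamma -> U -> V -> W) :=
  forall g, (forall v, zmod_morphism (f g ^~ v)) /\ (forall u, zmod_morphism (f g u)).

Section Theory.
Context (U V W : zmodType) (f : Gamma -> U -> V -> W).
Hypothesis f_biadd : biadditive f.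

Let convE c d :
  conv f c d = sum_map (fun g u => sum_map (fun h v => << f g u v *g (g * h)%g >>) d) c.
Proof. by []. Qed.

Let in_add g u : forall h, zmod_morphism (fun v => << f g u v *g (g * h)%g >>).
Proof. by move=> h v w /=; rewrite (f_biadd g).2 monalgUB. Qed.

Let out_add d :
  forall g, zmod_morphism (fun u => sum_map (fun h v => << f g u v *g (g * h)%g >>) d).
Proof.
move=> g u1 u2; rewrite /sum_map -sumrB; apply: eq_bigr => h _.
by rewrite (f_biadd g).1 monalgUB.
Qed.

Lemma conv_addl d : zmod_morphism (conv f ^~ d).
Proof. by move=> c1 c2; exact: (sum_map_additive (@out_add d)). Qed.

Lemma conv_addr c : zmod_morphism (conv f c).
Proof.
move=> d1 d2; rewrite /conv -sumrB; apply: eq_bigr => g _.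
exact: (sum_map_additive (@in_add g c@_g)).
Qed.

Lemma convUU g h u v :
  conv f << u *g g >> << v *g h >> = << f g u v *g (g * h)%g >>.
Proof. by rewrite convE (sum_mapU (@out_add _)) (sum_mapU (@in_add _ _)). Qed.

End Theory.

Lemma conv_assoc (U V W UV VW T : zmodType)
    (f1 : Gamma -> U -> V -> UV) (f2 : Gamma -> UV -> W -> T)
    (f3 : Gamma -> V -> W -> VW) (f4 : Gamma -> U -> VW -> T) :
    biadditive f1 -> biadditive f2 -> biadditive f3 -> biadditive f4 ->
    (forall g h u v w, f2 (g * h)%g (f1 g u v) w = f4 g u (f3 h v w)) ->
  forall a b c, conv f2 (conv f1 a b) c = conv f4 a (conv f3 b c).
Proof.
move=> f1P f2P f3P f4P fA a b c.
apply: (malg_additive_ext (F := fun a => conv f2 (conv f1 a b) c)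
                          (G := fun a => conv f4 a (conv f3 b c))).
- by move=> x y /=; rewrite conv_addl // conv_addl.
- exact: conv_addl.
move=> g u; apply: (malg_additive_ext (F := fun b => conv f2 (conv f1 _ b) c)
                          (G := fun b => conv f4 _ (conv f3 b c))).
- by move=> x y /=; rewrite conv_addr // conv_addl.
- by move=> x y /=; rewrite conv_addl // conv_addr.
move=> h v; apply: (malg_additive_ext (F := fun c => conv f2 (conv f1 _ _) c)
                          (G := fun c => conv f4 _ (conv f3 _ c))).
- exact: conv_addr.
- by move=> x y /=; rewrite conv_addr // conv_addr.
by move=> i w; rewrite !convUU // fA mulgA.
Qed.

End Convolution.

Lemma conv_scalel (k : nzRingType) (Gamma : monoidType) (U W : lmodType k) (V : zmodType)
    (f : Gamma -> U -> V -> W) (a : k) (c : dsum Gamma U) (d : {malg V[Gamma]}) :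
    biadditive f -> (forall g u v, f g (a *: u) v = a *: f g u v) ->
  conv f (a *: c) d = a *: (conv f c d : dsum Gamma W).
Proof.
move=> fP fZ; apply: (malg_additive_ext (F := fun c : dsum Gamma U => conv f (a *: c) d)
    (G := fun c => a *: (conv f c d : dsum Gamma W))).
- by move=> x y; rewrite scalerBr conv_addl.
- by move=> x y; rewrite conv_addl // scalerBr.
move=> g u; apply: (malg_additive_ext (F := conv f _)
    (G := fun d => a *: (conv f _ d : dsum Gamma W))).
- exact: conv_addr.
- by move=> x y; rewrite conv_addr // scalerBr.
by move=> h v; rewrite dsumZU !convUU // fZ dsumZU.
Qed.

Lemma conv_scaler (k : nzRingType) (Gamma : monoidType) (V W : lmodType k) (U : zmodType)
    (f : Gamma -> U -> V -> W) (a : k) (c : {malg U[Gamma]}) (d : dsum Gamma V) :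
    biadditive f -> (forall g u v, f g u (a *: v) = a *: f g u v) ->
  conv f c (a *: d) = a *: (conv f c d : dsum Gamma W).
Proof.
move=> fP fZ; apply: (malg_additive_ext (F := fun c => conv f c (a *: d))
    (G := fun c => a *: (conv f c d : dsum Gamma W))).
- by move=> x y; rewrite conv_addl.
- by move=> x y; rewrite conv_addl // scalerBr.
move=> g u; apply: (malg_additive_ext (F := fun d : dsum Gamma V => conv f _ (a *: d))
    (G := fun d => a *: (conv f _ d : dsum Gamma W))).
- by move=> x y; rewrite scalerBr conv_addr.
- by move=> x y; rewrite conv_addr // scalerBr.
by move=> h v; rewrite dsumZU !convUU // fZ dsumZU.
Qed.

(* A grading of [V] exhibits [V] as the internal direct sum of the subspaces
   [piece g]: [decomp] is the inverse of the summation map from the external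
   direct sum of the pieces to [V]. *)
Record grading (k : nzRingType) (Gamma : choiceType) (V : lmodType k) := Grading {
  piece : Gamma -> submodClosed V;
  decomp : V -> dsum Gamma V;
  decomp_piece : forall v g, (decomp v)@_g \in piece g;
  decompK : forall v, dsum_total (decomp v) = v;
  dsum_totalK : forall c : dsum Gamma V,
    (forall g, c@_g \in piece g) -> decomp (dsum_total c) = c
}.

Section GradingTheory.
Context (k : nzRingType) (Gamma : choiceType) (V : lmodType k) (G : grading Gamma V).

Lemma dsum_total_linear : linear (@dsum_total k Gamma V).
Proof.
have tB : zmod_morphism (@dsum_total k Gamma V) by exact: sum_map_additive.
apply: linear_intro => // a; apply: (malg_additive_ext
  (F := fun c : dsum Gamma V => dsum_total (a *: c)) (G := fun c => a *: dsum_total c)).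
- by move=> x y; rewrite scalerBr tB.
- by move=> x y; rewrite tB scalerBr.
by move=> g v; rewrite dsumZU /dsum_total !sum_mapU.
Qed.

Lemma dsum_totalU g (v : V) : dsum_total (<< v *g g >> : dsum Gamma V) = v.
Proof. by rewrite /dsum_total sum_mapU. Qed.

Lemma decomp_linear : linear (decomp G).
Proof.
move=> a u v; rewrite -{1}[u](decompK G) -{1}[v](decompK G) -dsum_total_linear.
rewrite dsum_totalK // => g.
by rewrite mcoeffD dsumZE rpredD ?rpredZ ?decomp_piece.
Qed.

Lemma decompU g v : v \in piece G g -> decomp G v = << v *g g >>.
Proof.
move=> vg; rewrite -{1}[v](dsum_totalU g) dsum_totalK // => h.
by rewrite mcoeffU; case: eqP => [<-|_]; rewrite ?mulr1n ?mulr0n ?rpred0.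
Qed.

End GradingTheory.

Record projections (k : nzRingType) (Gamma : choiceType) (W : lmodType k) :=
  Projections {
  proj : Gamma -> W -> W;
  proj_supp : W -> {fset Gamma};
  proj_linear : forall g, linear (proj g);
  proj_out : forall g w, g \notin proj_supp w -> proj g w = 0;
  proj_idem : forall g w, proj g (proj g w) = proj g w;
  proj_orth : forall g h w, g != h -> proj g (proj h w) = 0;
  proj_total : forall w, \sum_(g <- proj_supp w) proj g w = w
}.

Section ProjGrading.
Context (k : nzRingType) (Gamma : choiceType) (W : lmodType k).
Context (P : projections Gamma W).

Definition proj_piece (g : Gamma) : pred W := fun w => proj P g w == w.

Fact proj_piece_submod g : GRing.subsemimod_closed (proj_piece g).
Proof.
have pB := linear_additive (proj_linear P g).
split; first split.
- by rewrite unfold_in (additive0 pB).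
- by move=> u v; rewrite !unfold_in (additiveD pB) => /eqP-> /eqP->.
by move=> a u; rewrite !unfold_in (linear_scale (proj_linear P g)) => /eqP->.
Qed.

HB.instance Definition _ g :=
  GRing.isSubmodClosed.Build k W (proj_piece g) (proj_piece_submod g).

Definition proj_decomp (w : W) : dsum Gamma W :=
  [malg g in proj_supp P w => proj P g w].

Lemma proj_decompE w g : (proj_decomp w)@_g = proj P g w.
Proof. by rewrite mcoeffE; case: ifPn => // /proj_out ->. Qed.

Fact proj_decomp_piece w g : (proj_decomp w)@_g \in proj_piece g.
Proof. by rewrite proj_decompE unfold_in proj_idem. Qed.

Fact proj_decompK w : dsum_total (proj_decomp w) = w.
Proof.
rewrite -[RHS](proj_total P) /dsum_total (@sum_mapw _ _ _ _ _ (proj_supp P w)) //.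
  by apply: eq_bigr => g _; rewrite proj_decompE.
apply/fsubsetP => g; rewrite -mcoeff_neq0 proj_decompE.
by apply: contraR => /proj_out ->.
Qed.

Fact proj_totalK (c : dsum Gamma W) :
  (forall g, c@_g \in proj_piece g) -> proj_decomp (dsum_total c) = c.
Proof.
move=> cP; apply/malgP => g; rewrite proj_decompE.
have pB := linear_additive (proj_linear P g).
rewrite /dsum_total /sum_map (big_morph _ (additiveD pB) (additive0 pB)).
have projc h : proj P g c@_h = if h == g then c@_g else 0.
  have /eqP ch : proj P h c@_h == c@_h := cP h.
  by rewrite -{1}ch; case: eqP => [<-|/eqP ne]; [rewrite !ch | rewrite proj_orth // eq_sym].
under eq_bigr do rewrite projc.
have [gc|gc] := boolP (g \in msupp c).
  rewrite (big_fsetD1 g) //= eqxx big1_fset ?addr0 // => i.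
  by rewrite in_fsetD1 => /andP[/negbTE ->].
rewrite (mcoeff_outdom gc) big1_fset // => i ic _.
by case: eqP.
Qed.

Definition proj_grading : grading Gamma W :=
  @Grading k Gamma W (fun g => GRing.SubmodClosed.clone k W (proj_piece g) _) proj_decomp
    proj_decomp_piece proj_decompK proj_totalK.

End ProjGrading.

Section ExtSum.
Context (k : nzRingType) (Gamma : choiceType) (V : lmodType k).
Context (S : Gamma -> submodClosed V).

Definition ext_pred : pred (dsum Gamma V) :=
  fun c => all (fun g => c@_g \in S g) (msupp c).

Lemma ext_predP c : reflect (forall g, c@_g \in S g) (ext_pred c).
Proof.
apply: (iffP allP) => [cS g|cS g _]; last exact: cS.
by have [/cS//|/mcoeff_outdom ->] := boolP (g \in msupp c); rewrite rpred0.
Qed.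

Fact ext_pred_submod : GRing.subsemimod_closed ext_pred.
Proof.
split; first split.
- by apply/ext_predP => g; rewrite mcoeff0 rpred0.
- move=> c d /ext_predP cS /ext_predP dS; apply/ext_predP => g.
  by rewrite mcoeffD rpredD.
by move=> a c /ext_predP cS; apply/ext_predP => g; rewrite dsumZE rpredZ.
Qed.

HB.instance Definition _ :=
  GRing.isSubmodClosed.Build k (dsum Gamma V) ext_pred ext_pred_submod.

Record ext_sum := ExtSum { ext_val : dsum Gamma V; ext_valP : ext_pred ext_val }.

HB.instance Definition _ := [isSub for ext_val].
HB.instance Definition _ := [Choice of ext_sum by <:].
HB.instance Definition _ := [SubChoice_isSubLmodule of ext_sum by <:].

Lemma ext_valE (x : ext_sum) g : (ext_val x)@_g \in S g.
Proof. by move: g; apply/ext_predP/ext_valP. Qed.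

Fact ext_inP g v : v \in S g -> ext_pred (<< v *g g >>).
Proof.
move=> vg; apply/ext_predP => h.
by rewrite mcoeffU; case: eqP => [<-|_]; rewrite ?mulr1n ?mulr0n ?rpred0.
Qed.

Definition ext_in g v (vg : v \in S g) : ext_sum := ExtSum (ext_inP vg).

Definition ext_proj g (x : ext_sum) : ext_sum := ext_in (ext_valE x g).

Fact ext_proj_linear g : linear (ext_proj g).
Proof.
move=> a x y; apply/val_inj/malgP => h.
rewrite [RHS](_ : _ = (a *: ext_val (ext_proj g x) + ext_val (ext_proj g y))@_h) //.
rewrite mcoeffD dsumZE /= !mcoeffU mcoeffD dsumZE.
by case: (g == h); rewrite ?mulr1n ?mulr0n ?scaler0 ?addr0.
Qed.

Fact ext_proj_out g x : g \notin msupp (ext_val x) -> ext_proj g x = 0.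
Proof. by move=> gx; apply/val_inj => /=; rewrite mcoeff_outdom // monalgU0. Qed.

Fact ext_proj_idem g x : ext_proj g (ext_proj g x) = ext_proj g x.
Proof. by apply/val_inj => /=; rewrite mcoeffUU. Qed.

Fact ext_proj_orth g h x : g != h -> ext_proj g (ext_proj h x) = 0.
Proof.
move=> ne; apply/val_inj => /=.
by rewrite mcoeffU eq_sym (negbTE ne) mulr0n monalgU0.
Qed.

Fact ext_proj_total x : \sum_(g <- msupp (ext_val x)) ext_proj g x = x.
Proof.
by apply: val_inj; rewrite raddf_sum /= [RHS]monalgE.
Qed.

Definition ext_projections : projections Gamma ext_sum :=
  Projections ext_proj_linear ext_proj_out ext_proj_idem ext_proj_orth ext_proj_total.

Definition ext_grading : grading Gamma ext_sum := proj_grading ext_projections.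

End ExtSum.

(* The unit of [A] is not required to be homogeneous of degree [1]. *)
Record gralg (k : fieldType) (Gamma : monoidType) := GrAlg {
  gralg_alg :> algType k;
  gralg_grading : grading Gamma gralg_alg;
  gralg_mul : forall g h (a b : gralg_alg),
    a \in piece gralg_grading g -> b \in piece gralg_grading h ->
    a * b \in piece gralg_grading (g * h)%g
}.

(* [ract m a] is the right action [m a].  The equation [m 1 = m] is the separate
   predicate [unitary]: when the unit of [A] is not homogeneous of degree [1] and
   [Gamma] is not cancellative, it need not pass to the shifts of [M]. *)
Record grmod (k : fieldType) (Gamma : monoidType) (A : gralg k Gamma) := GrMod {
  grmod_mod :> lmodType k;
  grmod_grading : grading Gamma grmod_mod;
  ract : grmod_mod -> A -> grmod_mod;
  ract_linearl : forall a, linear (ract ^~ a);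
  ract_linearr : forall m, linear (ract m);
  ractA : forall m a b, ract (ract m a) b = ract m (a * b);
  ract_piece : forall g h m a,
    m \in piece grmod_grading g -> a \in piece (gralg_grading A) h ->
    ract m a \in piece grmod_grading (g * h)%g
}.

Definition alg_piece k Gamma (A : gralg k Gamma) (g : Gamma) : submodClosed A :=
  piece (gralg_grading A) g.
Definition mod_piece k Gamma (A : gralg k Gamma) (M : grmod A) (g : Gamma) :
  submodClosed M := piece (grmod_grading M) g.

Definition unitary k Gamma (A : gralg k Gamma) (M : grmod A) :=
  forall m : M, ract m 1 = m.

Definition annihilates k Gamma (A : gralg k Gamma) (M : grmod A) (a : A) :=
  forall m : M, ract m a = 0.

Definition is_grmod_iso k Gamma (A : gralg k Gamma) (M N : grmod A) (f : M -> N) :=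
  [/\ linear f, bijective f,
      forall m a, f (ract m a) = ract (f m) a &
      forall g m, m \in mod_piece M g -> f m \in mod_piece N g].

Definition is_basis (k : fieldType) (Gamma : choiceType) (V : lmodType k)
    (v : Gamma -> V) :=
  forall m, exists! c : {malg k[Gamma]}, m = \sum_(g <- msupp c) c@_g *: v g.

Section Shift.
Context (k : fieldType) (Gamma : monoidType) (A : gralg k Gamma).
Context (M : grmod A) (g : Gamma).

Definition shift_piece (h : Gamma) : submodClosed M := mod_piece M (g * h)%g.

(* [M(g)] is an external direct sum: if [Gamma] is not left cancellative, the same
   subspace [M_(g * h)] occurs in several degrees [h]. *)
Definition shift_mod := ext_sum shift_piece.

HB.instance Definition _ := GRing.Lmodule.on shift_mod.

(* [shift_in h m] is [m], an element of [M_(g * h)], as an element of [M(g)_h]. *)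
Definition shift_in (h : Gamma) (m : M) (mP : m \in shift_piece h) : shift_mod :=
  ext_in mP.

Let actP : biadditive (fun (_ : Gamma) (m : M) (a : A) => ract m a).
Proof.
move=> h; split=> ?; apply: linear_additive.
  exact: ract_linearl.
exact: ract_linearr.
Qed.

(* For [m] in [M(g)_h = M_(g * h)] and [a] in [A_h'], the element [m a] of
   [M_(g * h * h')] is taken in the summand [M(g)_(h * h')]. *)
Definition shift_act_val (c : dsum Gamma M) (a : A) : dsum Gamma M :=
  conv (fun _ m b => ract m b) c (decomp (gralg_grading A) a).

Fact shift_act_valP (x : shift_mod) (a : A) :
  ext_pred shift_piece (shift_act_val (ext_val x) a).
Proof.
apply/ext_predP => h; rewrite /shift_act_val /conv raddf_sum /=.
apply: rpred_sum => i _; rewrite raddf_sum /=; apply: rpred_sum => j _.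
rewrite mcoeffU; case: eqP => [<-|_]; last by rewrite mulr0n rpred0.
rewrite mulr1n /shift_piece mulgA; apply: ract_piece; last exact: decomp_piece.
exact: (ext_valE x).
Qed.

Definition shift_act (x : shift_mod) (a : A) : shift_mod :=
  ExtSum (shift_act_valP x a).

Fact shift_act_linearl a : linear (shift_act ^~ a).
Proof.
apply: linear_intro => [x y|b x]; apply: val_inj => /=.
  exact: conv_addl.
apply: conv_scalel => // _ u v; exact: (linear_scale (ract_linearl v)).
Qed.

Fact shift_act_linearr x : linear (shift_act x).
Proof.
have dP := decomp_linear (gralg_grading A).
apply: linear_intro => [a b|c a]; apply: val_inj => /=; rewrite /shift_act_val.
  by rewrite (linear_additive dP) conv_addr.
rewrite (linear_scale dP); apply: conv_scaler => // _ u v.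
exact: (linear_scale (ract_linearr u)).
Qed.

Let mulP : biadditive (fun (_ : Gamma) (a b : A) => a * b).
Proof. by move=> h; split=> a b c; rewrite (mulrBl, mulrBr). Qed.

Lemma decompM (a b : A) :
  decomp (gralg_grading A) (a * b) =
  conv (fun _ a b => a * b) (decomp (gralg_grading A) a) (decomp (gralg_grading A) b).
Proof.
set d := decomp _; rewrite -[a in LHS](decompK (gralg_grading A)).
rewrite -[b in LHS](decompK (gralg_grading A)) -/d.
transitivity (d (dsum_total (conv (fun _ a b => a * b) (d a) (d b) : dsum Gamma A))).
  congr (d _); rewrite {1}/dsum_total /sum_map mulr_suml /conv.
  have tP := linear_additive (@dsum_total_linear k Gamma A).
  rewrite (big_morph _ (additiveD tP) (additive0 tP)); apply: eq_bigr => i _.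
  rewrite (big_morph _ (additiveD tP) (additive0 tP)) mulr_sumr.
  by apply: eq_bigr => h _; rewrite dsum_totalU.
rewrite {1}/d dsum_totalK // => h; rewrite /conv raddf_sum /=.
apply: rpred_sum => i _; rewrite raddf_sum /=; apply: rpred_sum => j _.
rewrite mcoeffU; case: eqP => [<-|_]; last by rewrite mulr0n rpred0.
by rewrite mulr1n; apply: gralg_mul; apply: decomp_piece.
Qed.

Fact shift_actA x a b : shift_act (shift_act x a) b = shift_act x (a * b).
Proof.
apply: val_inj; rewrite /= /shift_act_val decompM; apply: conv_assoc => //.
by move=> _ _ m c d; rewrite ractA.
Qed.

Definition shift_grading : grading Gamma shift_mod := ext_grading _.

Fact shift_act_piece h i x a :
    x \in piece shift_grading h -> a \in piece (gralg_grading A) i ->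
  shift_act x a \in piece shift_grading (h * i)%g.
Proof.
rewrite !unfold_in => /eqP <- ai; apply/eqP/val_inj => /=.
by rewrite /shift_act_val (decompU ai) convUU // mcoeffUU.
Qed.

Definition shift : grmod A := @GrMod k Gamma A shift_mod shift_grading shift_act
  shift_act_linearl shift_act_linearr shift_actA shift_act_piece.

End Shift.

(* A reduced affine scheme over [k], given by its coordinate ring [k[X]], in which
   functions are determined by their values at the points below. *)
Record reduced_affine (k : fieldType) := ReducedAffine {
  coord_ring :> comAlgType k;
  coord_reduced : forall (f : coord_ring) n, f ^+ n = 0 -> f = 0;
  coord_separated : forall f f' : coord_ring,
    (forall x : {lrmorphism coord_ring -> k^o}, x f = x f') -> f = f'
}.

(* A closed point at which functions take values in [k] is given by its evaluation
   map [k[X] -> k], whose kernel is the corresponding maximal ideal. *)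
Definition point (k : fieldType) (X : reduced_affine k) :=
  {lrmorphism coord_ring X -> k^o}.

Definition value (k : fieldType) (X : reduced_affine k) (f : X) (x : point X) : k :=
  x f.

(* An automorphism [s] of [X] over [k] is given by its comorphism
   [s^* : k[X] -> k[X]]. *)
Record scheme_aut (k : fieldType) (X : reduced_affine k) := SchemeAut {
  pullback : {lrmorphism coord_ring X -> coord_ring X};
  pullback_bij : bijective pullback
}.

Definition aut_point (k : fieldType) (X : reduced_affine k) (s : scheme_aut X)
  (x : point X) : point X := x \o pullback s.

Lemma value_aut_point (k : fieldType) (X : reduced_affine k) (s : scheme_aut X)
    (f : X) (x : point X) :
  value f (aut_point s x) = value (pullback s f) x.
Proof. by []. Qed.

(* The composite [s \o t]; its comorphism is [t^* \o s^*]. *)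
Definition aut_comp (k : fieldType) (X : reduced_affine k) (s t : scheme_aut X) :
    scheme_aut X :=
  @SchemeAut k X (pullback t \o pullback s) (bij_comp (pullback_bij t) (pullback_bij s)).

Lemma aut_point_comp (k : fieldType) (X : reduced_affine k) (s t : scheme_aut X)
    (x : point X) :
  aut_point (aut_comp s t) x =1 aut_point s (aut_point t x).
Proof. by []. Qed.

Record aut_antihom (k : fieldType) (Gamma : monoidType) (X : reduced_affine k) :=
  AutAntihom {
  antihom_aut :> Gamma -> scheme_aut X;
  antihomM : forall g h,
    pullback (antihom_aut (g * h)%g) =1
    pullback (aut_comp (antihom_aut h) (antihom_aut g))
}.

(* The element [\sum_g f_g t^g] is the function with value [f_g] at [g]; the
   multiplication, defined below, depends on [sigma]. *)
Definition skewalg (k : fieldType) (Gamma : monoidType) (X : reduced_affine k)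
  (sigma : aut_antihom Gamma X) := dsum Gamma (coord_ring X).

Section SkewAlgebra.
Context (k : fieldType) (Gamma : monoidType) (X : reduced_affine k).
Context (sigma : aut_antihom Gamma X).

(* [f^g = f \o sigma^g]. *)
Definition aut_fun (f : X) (g : Gamma) : X := pullback (sigma g) f.

Lemma aut_funM f g h : aut_fun f (g * h)%g = aut_fun (aut_fun f h) g.
Proof. exact: antihomM. Qed.

Lemma aut_fun1 f : aut_fun f 1%g = f.
Proof.
have [s sK _] := pullback_bij (sigma 1%g); apply: (can_inj sK).
by rewrite -/(aut_fun _ _) -aut_funM mulg1.
Qed.

Local Notation skewalg := (skewalg sigma).

HB.instance Definition _ := GRing.Lmodule.on skewalg.

(* [f t^g] *)
Definition skew_monom (f : X) (g : Gamma) : skewalg := << f *g g >>.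

(* [(f t^g) (f' t^h) = f f'^g t^(g h)] *)
Definition skew_mul (c d : skewalg) : skewalg :=
  conv (fun g f f' => f * aut_fun f' g) c d.

Definition skew_one : skewalg := skew_monom 1 1%g.

Let mulP : biadditive (fun g (f f' : X) => f * aut_fun f' g).
Proof.
by move=> g; split=> f a b; rewrite ?mulrBl // /aut_fun rmorphB mulrBr.
Qed.

Lemma skew_mulUU f f' g h :
  skew_mul (skew_monom f g) (skew_monom f' h) =
  skew_monom (f * aut_fun f' g) (g * h)%g.
Proof. exact: convUU. Qed.

Fact skew_mulA : associative skew_mul.
Proof.
move=> a b c; apply/esym/conv_assoc => // g h f f' f''.
by rewrite aut_funM /aut_fun rmorphM mulrA.
Qed.

Fact skew_mul1l : left_id skew_one skew_mul.
Proof.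
apply: malg_additive_ext => [||g f]; [exact: conv_addr | by [] |].
by rewrite skew_mulUU mul1r mul1g aut_fun1.
Qed.

Fact skew_mul1r : right_id skew_one skew_mul.
Proof.
apply: malg_additive_ext => [||g f]; [exact: conv_addl | by [] |].
by rewrite skew_mulUU /aut_fun rmorph1 mulr1 mulg1.
Qed.

Fact skew_mulDl : left_distributive skew_mul +%R.
Proof. by move=> a b c; exact: (additiveD (conv_addl mulP c)). Qed.

Fact skew_mulDr : right_distributive skew_mul +%R.
Proof. by move=> a b c; exact: (additiveD (conv_addr mulP a)). Qed.

Fact skew_one_neq0 : skew_one != 0.
Proof. by rewrite monalgU_eq0 oner_eq0. Qed.

HB.instance Definition _ := GRing.Zmodule_isNzRing.Build skewalg
  skew_mulA skew_mul1l skew_mul1r skew_mulDl skew_mulDr skew_one_neq0.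

Fact skew_scaleAl (a : k) (c d : skewalg) : a *: (c * d) = (a *: c) * d.
Proof.
by apply/esym/conv_scalel => // g f f'; rewrite scalerAl.
Qed.

HB.instance Definition _ := GRing.Lmodule_isLalgebra.Build k skewalg skew_scaleAl.

Fact skew_scaleAr (a : k) (c d : skewalg) : a *: (c * d) = c * (a *: d).
Proof.
by apply/esym/conv_scaler => // g f f'; rewrite /aut_fun linearZ scalerAr.
Qed.

HB.instance Definition _ := GRing.Lalgebra_isAlgebra.Build k skewalg skew_scaleAr.

Lemma skew_tM g h : skew_monom 1 g * skew_monom 1 h = skew_monom 1 (g * h)%g.
Proof. by rewrite [LHS]skew_mulUU /aut_fun rmorph1 mulr1. Qed.

Lemma skew_tf f g :
  skew_monom 1 g * skew_monom f 1%g = skew_monom (aut_fun f g) 1%g * skew_monom 1 g.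
Proof.
by rewrite [LHS]skew_mulUU [RHS]skew_mulUU /aut_fun rmorph1 mulr1 mul1r mulg1 mul1g.
Qed.

Lemma skew_ft f g : skew_monom f 1%g * skew_monom 1 g = skew_monom f g.
Proof. by rewrite [LHS]skew_mulUU /aut_fun rmorph1 mulr1 mul1g. Qed.

Definition skew_proj (g : Gamma) (c : skewalg) : skewalg := skew_monom c@_g g.

Fact skew_proj_linear g : linear (skew_proj g).
Proof.
by move=> a c d; rewrite /skew_proj /skew_monom mcoeffD dsumZE dsumZU monalgUD.
Qed.

Fact skew_proj_out g (c : skewalg) : g \notin msupp c -> skew_proj g c = 0.
Proof. by move=> gc; rewrite /skew_proj mcoeff_outdom // /skew_monom monalgU0. Qed.

Fact skew_proj_idem g c : skew_proj g (skew_proj g c) = skew_proj g c.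
Proof. by rewrite /skew_proj mcoeffUU. Qed.

Fact skew_proj_orth g h c : g != h -> skew_proj g (skew_proj h c) = 0.
Proof.
by move=> ne; rewrite /skew_proj /skew_monom mcoeffU eq_sym (negbTE ne) monalgU0.
Qed.

Fact skew_proj_total (c : skewalg) : \sum_(g <- msupp c) skew_proj g c = c.
Proof. by rewrite -monalgE. Qed.

Definition skew_grading : grading Gamma skewalg :=
  proj_grading (Projections skew_proj_linear skew_proj_out skew_proj_idem
    skew_proj_orth skew_proj_total).

Lemma skew_pieceP g (c : skewalg) :
  reflect (exists f, c = skew_monom f g) (c \in piece skew_grading g).
Proof.
apply: (iffP eqP) => [<-|[f ->]]; first by exists (c@_g).
by rewrite /= /skew_proj mcoeffUU.
Qed.

Fact skew_grading_mul g h (c d : skewalg) :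
    c \in piece skew_grading g -> d \in piece skew_grading h ->
  c * d \in piece skew_grading (g * h)%g.
Proof.
move=> /skew_pieceP[f ->] /skew_pieceP[f' ->]; apply/skew_pieceP.
by exists (f * aut_fun f' g); rewrite [LHS]skew_mulUU.
Qed.

Definition skew_gralg : gralg k Gamma := GrAlg skew_grading_mul.

End SkewAlgebra.

(* Main.v *)
(* The isomorphism M^x(g) = M^{sigma^g x} computes the action on every basis
   vector: v^x_g r = phi(r)(sigma^g x) v^x_{gh} for r in A_h.  Comparing
   v^x_e (r s) with (v^x_e r) s then gives phi(r s) = phi(r) phi(s)^g for r in A_g,
   which is the rule for multiplying phi(r) t^g by phi(s) t^h.  The same formula
   shows that r annihilates all the M^x as soon as phi kills its homogeneous
   components r_g; conversely v^x_e r = sum_g phi(r_g)(x) v^x_g, so annihilation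
   forces every phi(r_g) to vanish. *)

Require Import Defs.
From HB Require Import structures.
From mathcomp Require Import all_boot all_order all_algebra.
From mathcomp Require Import finmap.
From mathcomp.multinomials Require Import monalg.

Set Implicit Arguments.
Unset Strict Implicit.
Unset Printing Implicit Defensive.

Import GRing.Theory.
Local Open Scope ring_scope.

(** [decompK] writes [u] as a finite sum of its homogeneous components. *)
Lemma homogeneous_ind (k : nzRingType) (Gamma : choiceType) (V : lmodType k)
    (G : grading Gamma V) (P : V -> Prop) :
    P 0 -> (forall u w, P u -> P w -> P (u + w)) ->
    (forall g u, u \in piece G g -> P u) ->
  forall u, P u.
Proof.
move=> P0 PD Phom u; rewrite -(decompK G u) /dsum_total /sum_map.
by apply: (big_ind P) => // g _; exact: Phom (decomp_piece G u g).
Qed.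

Lemma scale_zmod_morphism (k : nzRingType) (I : Type) (V : lmodType k) (v : I -> V) i :
  zmod_morphism (fun a : k => a *: v i).
Proof. by move=> a b; rewrite scalerBl. Qed.

(** The expansion in [is_basis] is convertible to this [sum_map], so injectivity is the uniqueness
    of coordinates. *)
Lemma is_basis_inj (k : fieldType) (Gamma : choiceType) (V : lmodType k)
    (v : Gamma -> V) :
  is_basis v -> injective (sum_map (fun g (a : k) => a *: v g)).
Proof.
move=> v_basis c d eq_cd; have [b [_ bU]] := v_basis (sum_map (fun g a => a *: v g) c).
by rewrite -(bU c erefl) -(bU d eq_cd).
Qed.

(** If [v g] were zero, [<< 1 *g g >>] and [0] would be two expansions of the zero vector. *)
Lemma is_basis_neq0 (k : fieldType) (Gamma : choiceType) (V : lmodType k)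
    (v : Gamma -> V) g :
  is_basis v -> v g != 0.
Proof.
move=> v_basis; apply/eqP => vg0.
have /eqP : << (1 : k) *g g >> = 0.
  apply: (is_basis_inj v_basis).
  have scaleB := scale_zmod_morphism v.
  by rewrite (additive0 (sum_map_additive scaleB)) (sum_mapU scaleB) vg0 scaler0.
by rewrite monalgU_eq0 oner_eq0.
Qed.

(* For [m] in [M(g)_e = M_g], the action of [a] in [A_h] on [M(g)] takes [m] to the
   degree [h] of [M(g)], even if [g h = g h'] for some [h' != h]. *)
Lemma shift_ractE (k : fieldType) (Gamma : monoidType) (A : gralg k Gamma)
    (M : grmod A) (g h : Gamma) (m : M) (mP : m \in shift_piece M g 1%g) (a : A) :
    a \in alg_piece A h ->
  (ext_val (ract (shift_in mP : shift M g) a))@_h = ract m a.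
Proof.
move=> aP; rewrite /= /shift_act_val (decompU aP) convUU ?mul1g ?mcoeffUU // => i.
split=> u; apply: linear_additive; [exact: ract_linearl | exact: ract_linearr].
Qed.

Section GradedMap.
Context (k : fieldType) (Gamma : choiceType) (V W : lmodType k).
Context (G : grading Gamma V) (f : {linear V -> W}).

(** With [f := phi] this is the map $\Phi$; with [f := x \o phi] it is the family of coordinates of
    $v^x_e u$. *)
Definition graded_map (u : V) : dsum Gamma W :=
  sum_map (fun g w => << f w *g g >>) (decomp G u).

Let monalgU_f_additive (g : Gamma) : zmod_morphism (fun u => << f u *g g >>).
Proof. by move=> u w; rewrite raddfB monalgUB. Qed.

Lemma graded_mapE u g : (graded_map u)@_g = f (decomp G u)@_g.
Proof.
apply: (malg_additive_ext (F := fun c : {malg V[Gamma]} => (sum_map _ c)@_g)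
  (G := fun c => f c@_g)) => [c d|c d|h w].
- by rewrite (sum_map_additive monalgU_f_additive) mcoeffB.
- by rewrite mcoeffB raddfB.
by rewrite (sum_mapU monalgU_f_additive) !mcoeffU; case: eqP; rewrite ?raddf0.
Qed.

Fact graded_map_linear : linear graded_map.
Proof.
move=> a u w; apply/malgP => g.
by rewrite mcoeffD dsumZE !graded_mapE decomp_linear mcoeffD dsumZE linearP.
Qed.

Lemma graded_mapU g u : u \in piece G g -> graded_map u = << f u *g g >>.
Proof. by move=> uP; rewrite /graded_map (decompU uP) (sum_mapU monalgU_f_additive). Qed.

End GradedMap.

Section IntermediateSeries.
Context (k : fieldType) (Gamma : monoidType) (A : gralg k Gamma).
Context (X : reduced_affine k) (M : point X -> grmod A).
Context (v : forall x : point X, Gamma -> M x).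
Context (phi : {linear A -> coord_ring X}) (sigma : aut_antihom Gamma X).
Hypothesis v_basis : forall x, is_basis (v x).
Hypothesis v_piece : forall x g, v x g \in mod_piece (M x) g.
Hypothesis phiP : forall x g r, r \in alg_piece A g ->
  ract (v x 1%g) r = value (phi r) x *: v x g.
Hypothesis sigmaP : forall x g,
  exists2 theta : shift (M x) g -> M (aut_point (sigma g) x),
    is_grmod_iso theta
  & forall h (vP : v x (g * h)%g \in shift_piece (M x) g h),
      theta (shift_in vP) = v (aut_point (sigma g) x) h.

Lemma ract_basis x g h r : r \in alg_piece A h ->
  ract (v x g) r = value (aut_fun sigma (phi r) g) x *: v x (g * h)%g.
Proof.
move=> rP; have [theta [theta_lin theta_bij theta_act _] thetaE] := sigmaP x g.
(* The factor [1] is kept: [thetaE] at [h = 1] sends this vector to the basis vector of degree [1]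
   at [aut_point (sigma g) x], where [phiP] applies. *)
have v1P : v x (g * 1)%g \in shift_piece (M x) g 1%g by exact: v_piece.
have vhP : v x (g * h)%g \in shift_piece (M x) g h by exact: v_piece.
set c := value _ _.
have eq_r : ract (shift_in v1P : shift (M x) g) r = c *: (shift_in vhP : shift (M x) g).
  (* After [theta], the coefficient on the left is the value of [phi r] at [aut_point (sigma g) x],
     which is convertible to [c]. *)
  apply: (bij_inj theta_bij).
  by rewrite theta_act thetaE (phiP _ rP) (linear_scale theta_lin) thetaE.
(* The shift is an external sum; reading off the component of degree [h] brings the equation back to
   [M x]. *)
have := congr1 (fun m : shift (M x) g => (ext_val m)@_h) eq_r.
rewrite shift_ractE // mulg1 => ->.
have -> : ext_val (c *: (shift_in vhP : shift (M x) g)) = c *: ext_val (shift_in vhP).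
  by [].
by rewrite dsumZE mcoeffUU.
Qed.

Lemma phiM g h r s : r \in alg_piece A g -> s \in alg_piece A h ->
  phi (r * s) = phi r * aut_fun sigma (phi s) g.
Proof.
move=> rP sP; apply: coord_separated => x.
have := ractA (v x 1%g) r s.
rewrite (phiP _ rP) (linear_scale (ract_linearl s)) (ract_basis _ _ sP) scalerA.
rewrite (phiP _ (gralg_mul rP sP)) => /eqP.
(* The nonzero vector [v x (g * h)] is cancelled, leaving an equality of values at [x]. *)
rewrite -subr_eq0 -scalerBl scaler_eq0 (negbTE (is_basis_neq0 _ (@v_basis x))) orbF.
by rewrite subr_eq0 rmorphM => /eqP.
Qed.

Let grA := gralg_grading A.

(** Together with [is_basis_inj], this recovers all the values $\phi(r_g)(x)$ from the action of [r]
    on the single vector [v x 1]. *)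
Lemma ract_basis1 x r :
  ract (v x 1%g) r =
  sum_map (fun g (a : k) => a *: v x g) (graded_map grA (x \o phi) r).
Proof.
have scaleB := scale_zmod_morphism (v x).
have sumB := sum_map_additive scaleB.
have actB := linear_additive (ract_linearr (v x 1%g)).
have mapB := linear_additive (graded_map_linear grA (x \o phi)).
elim/(homogeneous_ind (G := grA)): r => [|r s rE sE|g r rP].
- by rewrite (additive0 actB) (additive0 mapB) (additive0 sumB).
- by rewrite (additiveD actB) rE sE (additiveD mapB) (additiveD sumB).
by rewrite (phiP _ rP) (graded_mapU _ rP) (sum_mapU scaleB).
Qed.

Definition skew_map : A -> skew_gralg sigma := graded_map grA phi.

Fact skew_map_linear : linear skew_map.
Proof. exact: graded_map_linear. Qed.

HB.instance Definition _ := GRing.isLinear.Build k A (skew_gralg sigma) *:%R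
  skew_map skew_map_linear.

Lemma skew_mapU g r : r \in alg_piece A g -> skew_map r = skew_monom sigma (phi r) g.
Proof. exact: graded_mapU. Qed.

(** Both sides are additive in [r] and in [s]; on homogeneous elements the claim is [phiM]. *)
Lemma skew_mapM r s : skew_map (r * s) = skew_map r * skew_map s.
Proof.
elim/(homogeneous_ind (G := grA)): r => [|r1 r2 r1E r2E|g r rP].
- by rewrite mul0r linear0 mul0r.
- by rewrite mulrDl !linearD /= r1E r2E mulrDl.
elim/(homogeneous_ind (G := grA)): s => [|s1 s2 s1E s2E|h s sP].
- by rewrite mulr0 linear0 mulr0.
- by rewrite mulrDr !linearD /= s1E s2E mulrDr.
rewrite (skew_mapU (gralg_mul rP sP)) (skew_mapU rP) (skew_mapU sP).
by rewrite [RHS]skew_mulUU (phiM rP sP).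
Qed.

(* The unit of [A] need not be homogeneous; its components are read off from
   [v_e 1 = v_e]. *)
Lemma skew_map1 : (forall x, unitary (M x)) -> skew_map 1 = 1.
Proof.
move=> M_unitary; apply/malgP => g; apply: coord_separated => x.
have coord1 : graded_map grA (x \o phi) 1 = << (1 : k) *g 1%g >>.
  apply: (is_basis_inj (@v_basis x)).
  by rewrite -ract_basis1 M_unitary (sum_mapU (scale_zmod_morphism (v x))) scale1r.
rewrite graded_mapE -[LHS](graded_mapE grA (x \o phi)) coord1 !mcoeffU.
by case: eqP; rewrite ?rmorph1 ?rmorph0.
Qed.

Lemma skew_map_ker r : skew_map r = 0 <-> forall x, annihilates (M x) r.
Proof.
split=> [r0 x m|r0].
  have phi0 g : phi (decomp grA r)@_g = 0 by rewrite -graded_mapE -/skew_map r0 mcoeff0.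
  have actB := linear_additive (ract_linearl (g0 := M x) r).
  (* Expanding [m] in the basis and [r] in its components leaves terms $v^x_g r_h$, each a multiple
     of $v^x_{gh}$ by a value of $\phi(r_h)^g = 0$. *)
  have [c [-> _]] := @v_basis x m.
  rewrite (big_morph _ (additiveD actB) (additive0 actB)) big1 // => g _.
  rewrite (linear_scale (ract_linearl r)) -(decompK grA r) /dsum_total /sum_map.
  have basisB := linear_additive (ract_linearr (v x g)).
  rewrite (big_morph _ (additiveD basisB) (additive0 basisB)) big1 ?scaler0 // => h _.
  rewrite (ract_basis _ _ (decomp_piece grA r h)) phi0.
  by rewrite /aut_fun /value !raddf0 scale0r.
apply/malgP => g; rewrite mcoeff0; apply: coord_separated => x.
(* Only $v^x_e r = 0$ is used here: its coordinates are the $\phi(r_g)(x)$. *)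
have coord0 : graded_map grA (x \o phi) r = 0.
  apply: (is_basis_inj (@v_basis x)).
  by rewrite -ract_basis1 r0 (additive0 (sum_map_additive (scale_zmod_morphism (v x)))).
by rewrite graded_mapE raddf0 -[LHS](graded_mapE grA (x \o phi)) coord0 mcoeff0.
Qed.

End IntermediateSeries.

Theorem theorem2p2
  (k : closedFieldType) (char0 : [pchar k] =i pred0)
  (Gamma : monoidType) (A : gralg k Gamma) (X : reduced_affine k)
  (M : point X -> grmod A) (M_unitary : forall x, unitary (M x))
  (v : forall x : point X, Gamma -> M x)
  (v_basis : forall x, is_basis (v x))
  (v_span : forall x g m,
     m \in mod_piece (M x) g <-> exists c : k, m = c *: v x g)
  (phi : {linear A -> coord_ring X})
  (phiP : forall x g r, r \in alg_piece A g ->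
     ract (v x 1%g) r = value (phi r) x *: v x g)
  (sigma : aut_antihom Gamma X)
  (sigmaP : forall x g,
     exists2 theta : shift (M x) g -> M (aut_point (sigma g) x),
       is_grmod_iso theta
     & forall h (vP : v x (g * h)%g \in shift_piece (M x) g h),
         theta (shift_in vP) = v (aut_point (sigma g) x) h) :
  exists Phi : {lrmorphism A -> skew_gralg sigma},
    [/\ forall g r, r \in alg_piece A g -> Phi r = skew_monom sigma (phi r) g,
        forall Psi : {linear A -> skew_gralg sigma},
          (forall g r, r \in alg_piece A g -> Psi r = skew_monom sigma (phi r) g) ->
          Psi =1 Phi,
        forall g r, r \in alg_piece A g ->
          Phi r \in alg_piece (skew_gralg sigma) g &
        forall r, Phi r = 0 <-> forall x, annihilates (M x) r].
Proof.
have v_piece x g : v x g \in mod_piece (M x) g.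
  by apply/v_span; exists 1; rewrite scale1r.
have PhiU := skew_mapU phi sigma.
have PhiM : monoid_morphism (skew_map phi sigma).
  split; last exact: skew_mapM v_basis v_piece phiP sigmaP.
  exact: skew_map1 v_basis phiP M_unitary.
pose PhiRM := GRing.isMonoidMorphism.Build A (skew_gralg sigma) (skew_map phi sigma) PhiM.
pose Phi : {lrmorphism A -> skew_gralg sigma} := HB.pack (skew_map phi sigma) PhiRM.
exists Phi; split=> [g r rP|Psi PsiU r|g r rP|r].
- exact: PhiU.
(* Linear maps that agree on homogeneous elements are equal. *)
- elim/(homogeneous_ind (G := gralg_grading A)): r => [|r s rE sE|g r rP].
  + by rewrite !linear0.
  + by rewrite !linearD rE sE.
  by rewrite (PsiU _ _ rP) -(PhiU _ _ rP).
- by apply/skew_pieceP; exists (phi r); apply: PhiU.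
exact: skew_map_ker v_basis v_piece phiP sigmaP r.
Qed.
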